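(* Let $A$ be an abelian group, $(M,* )$ an abelian group with involution, and $\lambda:A\times A\to(M,* )$ a hermitian form. The quadratic form $(\lambda,\mu_\lambda):A\to\mathfrak M_\lambda$ is initial in the category of quadratic refinements of $\lambda$. In fact, the forgetful functor $R:\mathsf{QF}\to\mathsf{HF}$, $R(\lambda,\mu)=\lambda$, from the category of (non-commutative) quadratic forms to the category of hermitian forms has a left adjoint $L:\mathsf{HF}\to\mathsf{QF}$ given by $L(\lambda):=(\lambda,\mu_\lambda)$.
   Context: Quadratic groups. A (non-commutative) quadratic group $\mathfrak M=(M_e\overset{h}{\to}M_{ee}\overset{p}{\to}M_e)$ consists of two groups $M_e,M_{ee}$ (written additively, $M_e$ not necessarily commutative) and two homomorphisms $h,p$ such that $M_{ee}$ is abelian, the image of $p$ lies in the center of $M_e$, and $hph=2h$. Then $*:=hp-\mathrm{id}$ is an involution on $M_{ee}$. A morphism $\beta:\mathfrak M\to\mathfrak M'$ is a pair of homomorphisms $\beta_e:M_e\to M'_e$, $\beta_{ee}:M_{ee}\to M'_{ee}$ with $h'\beta_e=\beta_{ee}h$ and $p'\beta_{ee}=\beta_e p$. $\mathfrak M$ is a quadratic refinement of an abelian group with involution $(M,* )$ if $M_{ee}=M$ and $*=hp-\mathrm{id}$. Quadratic forms. A quadratic form $(\lambda,\mu):A\to\mathfrak M$ on an abelian group $A$ is a bilinear map $\lambda:A\times A\to M_{ee}$ and a map $\mu:A\to M_e$ with $\mu(a+a')=\mu(a)+\mu(a')+p(\lambda(a,a'))$ and $h(\mu(a))=\lambda(a,a)$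 for all $a,a'\in A$. The category $\mathsf{QF}$ has quadratic forms (the groups $A$ and $\mathfrak M$ being part of the data) as objects; a morphism $(\lambda,\mu)\to(\lambda',\mu')$ is a homomorphism $\alpha:A\to A'$ and a morphism $\beta=(\beta_e,\beta_{ee}):\mathfrak M\to\mathfrak M'$ with $\lambda'(\alpha(a_1),\alpha(a_2))=\beta_{ee}(\lambda(a_1,a_2))$ and $\mu'\circ\alpha=\beta_e\circ\mu$. Hermitian forms. A hermitian form $\lambda:A\times A\to(M,* )$ is a bilinear map into an abelian group with involution such that $\lambda(a',a)=\lambda(a,a')^*$. The category $\mathsf{HF}$ has these as objects ($A$ and $(M,* )$ being part of the data); a morphism $\lambda\to\lambda'$ is a pair of homomorphisms $\alpha:A\to A'$, $\beta_{ee}:(M,* )\to(M',*')$, the latter commuting with the involutions, with $\lambda'(\alpha(a_1),\alpha(a_2))=\beta_{ee}(\lambda(a_1,a_2))$. For a quadratic form $(\lambda,\mu)$, $\lambda$ is hermitian with respect to $*=hp-\mathrm{id}$, so $R$ (forgetting $\mu$ and $\beta_e$) is defined. The category of quadratic refinements of a hermitian form $\lambda:A\times A\to(M,* )$: objects are quadratic forms $(\lambda,\mu):A\to\mathfrak M$ with $\mathfrak M$ a quadratic refinement of $(M,* )$; morphisms are morphisms in $\mathsf{QF}$ lying over the identity of $\lambda$ ($\alpha=\mathrm{id}_A$, $\beta_{ee}=\mathrm{id}_M$). Construction of $(\lambda,\mu_\lambda)$. Given a hermitian form $\lambda:A\times A\to(M,* )$, set $M_{ee}:=M$ and let $M_e:=M\times_\lambda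 A$ be the set $M\times A$ with group law $(m,a)+(m',a'):=(m+m'-\lambda(a,a'),\,a+a')$. Put $p_\lambda(m):=(m,0)$, $h_\lambda(m,a):=m+m^*+\lambda(a,a)$, and $\mu_\lambda(a):=(0,a)$. Then $\mathfrak M_\lambda=(M_e\overset{h_\lambda}{\to}M_{ee}\overset{p_\lambda}{\to}M_e)$ is a quadratic group refining $(M,* )$ and $(\lambda,\mu_\lambda):A\to\mathfrak M_\lambda$ is a quadratic form. *)

(* Defs.v *)
From HB Require Import structures.
From mathcomp Require Import all_boot ssralg boolp.

Set Implicit Arguments.
Unset Strict Implicit.
Unset Printing Implicit Defensive.

Import GRing.Theory.
Local Open Scope ring_scope.

Record category := Category {
  ob :> Type;
  hom : ob -> ob -> Type;
  cat_id : forall X, hom X X;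
  cat_comp : forall X Y Z, hom Y Z -> hom X Y -> hom X Z;
  cat_idl : forall X Y (f : hom X Y), cat_comp (cat_id Y) f = f;
  cat_idr : forall X Y (f : hom X Y), cat_comp f (cat_id X) = f;
  cat_compA : forall X Y Z W (f : hom Z W) (g : hom Y Z) (k : hom X Y),
    cat_comp f (cat_comp g k) = cat_comp (cat_comp f g) k
}.
Arguments hom {c} _ _.
Arguments cat_id {c} _.
Arguments cat_comp {c X Y Z} _ _.

Record functor (C D : category) := Functor {
  fobj :> C -> D;
  fmap : forall X Y : C, hom X Y -> hom (fobj X) (fobj Y);
  fmap_id : forall X : C, fmap (cat_id X) = cat_id (fobj X);
  fmap_comp : forall (X Y Z : C) (f : hom Y Z) (g : hom X Y),
    fmap (cat_comp f g) = cat_comp (fmap f) (fmap g)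
}.
Arguments fmap {C D} _ {X Y} _.

Definition initial (C : category) (X : C) : Prop :=
  forall Y : C, exists f : hom X Y, forall g : hom X Y, g = f.

Arguments initial : clear implicits.

Definition left_adjoint (C D : category) (L : functor C D) (R : functor D C) :
    Prop :=
  exists phi : forall (X : C) (Y : D), hom (L X) Y -> hom X (R Y),
    [/\ forall X Y, bijective (phi X Y),
        forall (X X' : C) (Y : D) (f : hom X' X) (g : hom (L X) Y),
          phi X' Y (cat_comp g (fmap L f)) = cat_comp (phi X Y g) f
      & forall (X : C) (Y Y' : D) (k : hom Y Y') (g : hom (L X) Y),
          phi X Y' (cat_comp k g) = cat_comp (fmap R k) (phi X Y g)].

Lemma additive_ext (U V : zmodType) (f g : {additive U -> V}) : f =1 g -> f = g.
Proof.
case: f g => f [[Hf]] [g [[Hg]]] /= fg.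
have E : f = g by apply/funext.
by subst g; rewrite (Prop_irrelevance Hf Hg).
Qed.

Lemma multiplicative_ext (U V : groupType) (f g : {multiplicative U -> V}) :
  f =1 g -> f = g.
Proof.
case: f g => f [[Hf]] [g [[Hg]]] /= fg.
have E : f = g by apply/funext.
by subst g; rewrite (Prop_irrelevance Hf Hg).
Qed.

Definition biadditive (A M : zmodType) (lam : A -> A -> M) : Prop :=
  (forall a, {morph lam a : x y / x + y}) /\
  (forall a, {morph lam^~ a : x y / x + y}).

Record invZmodType := InvZmod {
  inv_sort :> zmodType;
  star : {additive inv_sort -> inv_sort};
  starK : involutive star
}.
Arguments star {i}.

Record hermitian (A : zmodType) (M : invZmodType) := Hermitian {
  herm_fun :> A -> A -> M;
  herm_biadd : biadditive herm_fun;
  herm_sym : forall a a', herm_fun a' a = star (herm_fun a a')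
}.

Record hf_obj := HFObj {
  hf_A : zmodType;
  hf_M : invZmodType;
  hf_form : hermitian hf_A hf_M
}.

Record hf_hom (X Y : hf_obj) := HFHom {
  hf_alpha : {additive hf_A X -> hf_A Y};
  hf_beta : {additive hf_M X -> hf_M Y};
  hf_beta_star : forall m, hf_beta (star m) = star (hf_beta m);
  hf_formE : forall a1 a2,
    hf_form Y (hf_alpha a1) (hf_alpha a2) = hf_beta (hf_form X a1 a2)
}.

Lemma hf_hom_ext X Y (f g : hf_hom X Y) :
  hf_alpha f =1 hf_alpha g -> hf_beta f =1 hf_beta g -> f = g.
Proof.
case: f g => [fa fb f1 f2] [ga gb g1 g2] /= /additive_ext ea /additive_ext eb.
subst ga gb.
by rewrite (Prop_irrelevance f1 g1) (Prop_irrelevance f2 g2).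
Qed.

Definition hf_id X : hf_hom X X.
Proof. by exists idfun idfun. Defined.

Definition hf_comp X Y Z (g : hf_hom Y Z) (f : hf_hom X Y) : hf_hom X Z.
Proof.
exists (hf_alpha g \o hf_alpha f) (hf_beta g \o hf_beta f).
- by move=> m /=; rewrite !hf_beta_star.
- by move=> a1 a2 /=; rewrite !hf_formE.
Defined.

Definition HF : category.
Proof. by exists hf_obj hf_hom hf_id hf_comp => *; apply: hf_hom_ext. Defined.

(* M_ee is a parameter, so that a refinement of (M, star) has M_ee = M
   definitionally. As M_e may be non-commutative it is a groupType, whose law
   is written multiplicatively. *)
Record quadGroup (Mee : zmodType) := QuadGroup {
  qg_e :> groupType;
  qg_h : qg_e -> Mee;
  qg_p : Mee -> qg_e;
  qg_hM : {morph qg_h : x y / (x * y)%g >-> x + y};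
  qg_pD : {morph qg_p : x y / x + y >-> (x * y)%g};
  qg_p_central : forall m x, commute (qg_p m) x;
  qg_hph : forall x, qg_h (qg_p (qg_h x)) = qg_h x *+ 2
}.
Arguments qg_h {Mee q}.
Arguments qg_p {Mee q}.

Record quadGroup_hom (Mee Mee' : zmodType)
    (Q : quadGroup Mee) (Q' : quadGroup Mee') := QuadGroupHom {
  beta_e : {multiplicative Q -> Q'};
  beta_ee : {additive Mee -> Mee'};
  beta_h : forall x, qg_h (beta_e x) = beta_ee (qg_h x);
  beta_p : forall m, qg_p (beta_ee m) = beta_e (qg_p m)
}.

Definition qg_star (Mee : zmodType) (Q : quadGroup Mee) (m : Mee) : Mee :=
  qg_h (qg_p m : Q) - m.

Lemma qg_star_additive (Mee : zmodType) (Q : quadGroup Mee) :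
  zmod_morphism (qg_star Q).
Proof.
have D : {morph qg_star Q : x y / x + y}.
  by move=> x y; rewrite /qg_star qg_pD qg_hM opprD addrACA.
move=> x y; apply: (addIr (qg_star Q y)).
by rewrite -D !subrK.
Qed.

HB.instance Definition _ (Mee : zmodType) (Q : quadGroup Mee) :=
  GRing.isZmodMorphism.Build Mee Mee (qg_star Q) (qg_star_additive Q).

Lemma qg_starK (Mee : zmodType) (Q : quadGroup Mee) : involutive (qg_star Q).
Proof.
move=> m; rewrite {2}/qg_star raddfB /=.
rewrite {1}/qg_star qg_hph mulr2n addrK /qg_star opprB addrC subrK.
by [].
Qed.

Definition qg_inv (Mee : zmodType) (Q : quadGroup Mee) : invZmodType :=
  @InvZmod Mee (qg_star Q) (@qg_starK Mee Q).

Definition refines (M : invZmodType) (Q : quadGroup M) : Prop :=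
  forall m : M, star m = qg_star Q m.

Record quad_form (A Mee : zmodType) (Q : quadGroup Mee)
    (lam : A -> A -> Mee) (mu : A -> Q) : Prop := QuadForm {
  quad_biadd : biadditive lam;
  quad_muD : forall a a', mu (a + a') = (mu a * mu a' * qg_p (lam a a'))%g;
  quad_hmu : forall a, qg_h (mu a) = lam a a
}.

Record qf_obj := QFObj {
  qf_A : zmodType;
  qf_Mee : zmodType;
  qf_Q : quadGroup qf_Mee;
  qf_lambda : qf_A -> qf_A -> qf_Mee;
  qf_mu : qf_A -> qf_Q;
  qf_form : quad_form qf_lambda qf_mu
}.

Record qf_hom (X Y : qf_obj) := QFHom {
  qf_alpha : {additive qf_A X -> qf_A Y};
  qf_beta : quadGroup_hom (qf_Q X) (qf_Q Y);
  qf_lambdaE : forall a1 a2,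
    qf_lambda (qf_alpha a1) (qf_alpha a2) = beta_ee qf_beta (qf_lambda a1 a2);
  qf_muE : forall a, qf_mu (qf_alpha a) = beta_e qf_beta (qf_mu a)
}.

Lemma qf_hom_ext X Y (f g : qf_hom X Y) :
  qf_alpha f =1 qf_alpha g ->
  beta_e (qf_beta f) =1 beta_e (qf_beta g) ->
  beta_ee (qf_beta f) =1 beta_ee (qf_beta g) -> f = g.
Proof.
case: f g => [fa [fe fee f1 f2] f3 f4] [ga [ge gee g1 g2] g3 g4] /=.
move=> /additive_ext ea /multiplicative_ext ee /additive_ext eee.
subst ga ge gee; move: f3 f4 g3 g4.
rewrite (Prop_irrelevance f1 g1) (Prop_irrelevance f2 g2) => f3 f4 g3 g4.
by rewrite (Prop_irrelevance f3 g3) (Prop_irrelevance f4 g4).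
Qed.

Definition quadGroup_id (Mee : zmodType) (Q : quadGroup Mee) :
  quadGroup_hom Q Q.
Proof. by exists idfun idfun. Defined.

Definition quadGroup_comp (M1 M2 M3 : zmodType)
    (Q1 : quadGroup M1) (Q2 : quadGroup M2) (Q3 : quadGroup M3)
    (g : quadGroup_hom Q2 Q3) (f : quadGroup_hom Q1 Q2) : quadGroup_hom Q1 Q3.
Proof.
exists (beta_e g \o beta_e f) (beta_ee g \o beta_ee f).
- by move=> x /=; rewrite !beta_h.
- by move=> m /=; rewrite !beta_p.
Defined.

Definition qf_id X : qf_hom X X.
Proof. by exists idfun (quadGroup_id (qf_Q X)). Defined.

Definition qf_comp X Y Z (g : qf_hom Y Z) (f : qf_hom X Y) : qf_hom X Z.
Proof.
exists (qf_alpha g \o qf_alpha f) (quadGroup_comp (qf_beta g) (qf_beta f)).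
- by move=> a1 a2 /=; rewrite !qf_lambdaE.
- by move=> a /=; rewrite !qf_muE.
Defined.

Definition QF : category.
Proof. by exists qf_obj qf_hom qf_id qf_comp => *; apply: qf_hom_ext. Defined.

Lemma quad_herm (A Mee : zmodType) (Q : quadGroup Mee) (lam : A -> A -> Mee)
    (mu : A -> Q) :
  quad_form lam mu -> forall a a', lam a' a = qg_star Q (lam a a').
Proof.
case=> -[linr linl] muD hmu a a'; have := hmu (a + a').
rewrite muD !qg_hM !hmu (linl (a + a') a a') !linr /qg_star.
by rewrite [lam a' a + _]addrC addrACA => /addrI ->; rewrite addrAC subrr add0r.
Qed.

Definition forget_obj (X : qf_obj) : hf_obj :=
  @HFObj (qf_A X) (qg_inv (qf_Q X))
    (@Hermitian (qf_A X) (qg_inv (qf_Q X)) (@qf_lambda X)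
       (quad_biadd (qf_form X)) (quad_herm (qf_form X))).

Definition forget_hom (X Y : qf_obj) (f : qf_hom X Y) :
  hf_hom (forget_obj X) (forget_obj Y).
Proof.
exists (qf_alpha f) (beta_ee (qf_beta f)).
- by move=> m /=; rewrite /qg_star raddfB -beta_h -beta_p.
- exact: qf_lambdaE.
Defined.

Definition forget : functor QF HF.
Proof. by exists forget_obj forget_hom => *; apply: hf_hom_ext. Defined.

Record refinement (A : zmodType) (M : invZmodType) (lam : hermitian A M) :=
    Refinement {
  ref_Q : quadGroup M;
  ref_refines : refines ref_Q;
  ref_mu : A -> ref_Q;
  ref_form : quad_form lam ref_mu
}.

Definition qf_of_refinement (A : zmodType) (M : invZmodType)
    (lam : hermitian A M) (X : refinement lam) : qf_obj :=
  QFObj (ref_form X).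
Coercion qf_of_refinement : refinement >-> qf_obj.

Record refinement_hom (A : zmodType) (M : invZmodType) (lam : hermitian A M)
    (X Y : refinement lam) := RefinementHom {
  ref_hom :> qf_hom X Y;
  ref_alpha_id : forall a : A, qf_alpha ref_hom a = a;
  ref_beta_ee_id : forall m : M, beta_ee (qf_beta ref_hom) m = m
}.

Lemma refinement_hom_ext (A : zmodType) (M : invZmodType)
    (lam : hermitian A M) (X Y : refinement lam) (f g : refinement_hom X Y) :
  beta_e (qf_beta f) =1 beta_e (qf_beta g) -> f = g.
Proof.
case: f g => [f f1 f2] [g g1 g2] /= e; have E : f = g.
  by apply: qf_hom_ext => // x; rewrite ?f1 ?g1 ?f2 ?g2.
by subst g; rewrite (Prop_irrelevance f1 g1) (Prop_irrelevance f2 g2).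
Qed.

Definition refinement_id (A : zmodType) (M : invZmodType)
    (lam : hermitian A M) (X : refinement lam) : refinement_hom X X.
Proof. by exists (qf_id X). Defined.

Definition refinement_comp (A : zmodType) (M : invZmodType)
    (lam : hermitian A M) (X Y Z : refinement lam)
    (g : refinement_hom Y Z) (f : refinement_hom X Y) : refinement_hom X Z.
Proof.
exists (qf_comp g f).
- by move=> a /=; rewrite !ref_alpha_id.
- by move=> m /=; rewrite !ref_beta_ee_id.
Defined.

Definition Refinements (A : zmodType) (M : invZmodType) (lam : hermitian A M) :
  category.
Proof.
exists (refinement lam) (@refinement_hom A M lam) (@refinement_id A M lam)
  (@refinement_comp A M lam) => *; exact: refinement_hom_ext.
Defined.

(* An alias of M * A, so that the twisted law [tw_add] does not clash with the
   canonical direct product structure. *)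
Definition twprod (A : zmodType) (M : invZmodType) (lam : hermitian A M) :
  Type := (M * A)%type.

HB.instance Definition _ (A : zmodType) (M : invZmodType)
  (lam : hermitian A M) := Choice.on (twprod lam).

Section TwistedProduct.
Variables (A : zmodType) (M : invZmodType) (lam : hermitian A M).
Implicit Types x y : twprod lam.

Definition tw_add x y : twprod lam :=
  (x.1 + y.1 - lam x.2 y.2, x.2 + y.2).
Definition tw_zero : twprod lam := (0, 0).
Definition tw_opp x : twprod lam := (- x.1 - lam x.2 x.2, - x.2).

Lemma hermDr a b c : lam a (b + c) = lam a b + lam a c.
Proof. exact: (herm_biadd lam).1. Qed.
Lemma hermDl a b c : lam (a + b) c = lam a c + lam b c.
Proof. exact: (herm_biadd lam).2. Qed.
Lemma herm0r a : lam a 0 = 0.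
Proof. by apply: (addrI (lam a 0)); rewrite -hermDr !addr0. Qed.
Lemma herm0l a : lam 0 a = 0.
Proof. by apply: (addrI (lam 0 a)); rewrite -hermDl !addr0. Qed.
Lemma hermNr a b : lam a (- b) = - lam a b.
Proof. by apply: (addrI (lam a b)); rewrite -hermDr !subrr herm0r. Qed.
Lemma hermNl a b : lam (- a) b = - lam a b.
Proof. by apply: (addrI (lam a b)); rewrite -hermDl !subrr herm0l. Qed.

Lemma tw_addA : associative tw_add.
Proof.
move=> [m a] [m' a'] [m2 a2]; congr pair => /=; last by rewrite addrA.
rewrite hermDr hermDl !opprD !addrA [m + m' - _ + _]addrAC.
by rewrite [X in X - _]addrAC; exact: addrAC.
Qed.
Lemma tw_add0 : left_id tw_zero tw_add.
Proof. by case=> m a; congr pair; rewrite /= ?herm0l ?subr0 add0r. Qed.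
Lemma tw_addr0 : right_id tw_zero tw_add.
Proof. by case=> m a; congr pair; rewrite /= ?herm0r ?subr0 addr0. Qed.
Lemma tw_addN : left_inverse tw_zero tw_opp tw_add.
Proof.
case=> m a; congr pair => /=; last by rewrite addNr.
by rewrite hermNl opprK addrAC subrK addNr.
Qed.
Lemma tw_addrN : right_inverse tw_zero tw_opp tw_add.
Proof.
case=> m a; congr pair => /=; last by rewrite subrr.
by rewrite hermNr opprK addrA subrK subrr.
Qed.

HB.instance Definition _ := isGroup.Build (twprod lam)
  tw_addA tw_add0 tw_addr0 tw_addN tw_addrN.

Definition tw_p (m : M) : twprod lam := (m, 0).
Definition tw_h x : M := x.1 + star x.1 + lam x.2 x.2.
Definition tw_mu (a : A) : twprod lam := (0, a).

Lemma tw_mulE x y : (x * y)%g = tw_add x y. Proof. by []. Qed.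

Lemma tw_hM : {morph tw_h : x y / (x * y)%g >-> x + y}.
Proof.
case=> m a [m' a']; rewrite tw_mulE /tw_h /tw_add /=.
rewrite raddfB raddfD /= -herm_sym hermDl !hermDr.
set u := star m; set v := star m'.
have -> : m + m' - lam a a' + (u + v - lam a' a) =
          m + u + (m' + v) - (lam a a' + lam a' a).
  by rewrite addrACA [in LHS](addrACA m) opprD.
have -> : lam a a + lam a a' + (lam a' a + lam a' a') =
          lam a a + lam a' a' + (lam a a' + lam a' a).
  by rewrite [lam a' a + _]addrC addrACA.
rewrite [lam a a + _ + _]addrC addrA subrK.
by rewrite addrACA.
Qed.

Lemma tw_pD : {morph tw_p : x y / x + y >-> (x * y)%g}.
Proof. by move=> m m'; rewrite tw_mulE /tw_add /= herm0r subr0 addr0. Qed.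

Lemma tw_p_central m x : commute (tw_p m) x.
Proof.
rewrite /commute !tw_mulE /tw_add /= herm0l herm0r !subr0 addr0 add0r.
by rewrite addrC.
Qed.

Lemma tw_hp m : tw_h (tw_p m) = m + star m.
Proof. by rewrite /tw_h /= herm0l addr0. Qed.

Lemma tw_hph x : tw_h (tw_p (tw_h x)) = tw_h x *+ 2.
Proof.
rewrite tw_hp mulr2n; congr (_ + _).
by rewrite /tw_h !raddfD /= starK -herm_sym [star _ + _]addrC.
Qed.

Definition twQuadGroup : quadGroup M :=
  @QuadGroup M (twprod lam) tw_h tw_p tw_hM tw_pD tw_p_central tw_hph.

Lemma tw_refines : refines twQuadGroup.
Proof. by move=> m; rewrite /qg_star /= tw_hp addrC addKr. Qed.

Lemma tw_form : @quad_form A M twQuadGroup lam tw_mu.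
Proof.
split=> [|a a'|a]; first exact: herm_biadd.
  rewrite !tw_mulE /tw_add /tw_mu /tw_p /= herm0r !subr0 !addr0 add0r.
  by rewrite addNr.
by rewrite /= /tw_h /= raddf0 !add0r.
Qed.

Definition tw_refinement : refinement lam := Refinement tw_refines tw_form.

End TwistedProduct.

(* Main.v *)
From HB Require Import structures.
Require Import Defs.
From mathcomp Require Import all_boot ssralg.

(** Every element of the twisted product decomposes as
    [(m, a) = p_lambda m * mu_lambda a], so a morphism [g] out of
    [(lambda, mu_lambda)] satisfies
    [beta_e (m, a) = p (beta_ee m) * mu (alpha a)]: it is determined by its
    underlying morphism of hermitian forms ([tw_beta_eE], [tw_hom_ext]).

    Conversely, for any quadratic form [Y] and any morphism of hermitian forms
    [f] from [lambda] to [R Y], the formula on the right defines a morphism in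
    [QF] ([tw_lift]).  The group law of the twisted product is chosen for
    this: [p] is central, and [mu b * mu b' = p (- lambda (b, b')) * mu (b + b')]
    reproduces exactly the cocycle [- lambda].  Compatibility with [h] uses
    that [beta_ee] respects the involutions, since [h (p m) = m + m^*].

    So restricting along the unit and lifting are mutually inverse, which
    makes [forget] a right adjoint; the action of [L] on morphisms is obtained
    by lifting.  Initiality among the refinements of a fixed [lambda] is the
    part of this bijection lying over the identity of [lambda]. *)

Set Implicit Arguments.
Unset Strict Implicit.
Unset Printing Implicit Defensive.

Import GRing.Theory.
Local Open Scope ring_scope.

(** * Quadratic forms in a possibly non-commutative target *)

Lemma qg_p0 (Mee : zmodType) (Q : quadGroup Mee) : qg_p 0 = 1%g :> Q.
Proof. by apply: (@mulgI Q (qg_p 0)); rewrite -qg_pD addr0 mulg1. Qed.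

Section QuadForm.
Variables (A Mee : zmodType) (Q : quadGroup Mee).
Variables (lam : A -> A -> Mee) (mu : A -> Q).
Hypothesis lam_mu : quad_form lam mu.

Lemma quad_mu0 : mu 0 = 1%g.
Proof.
have lam00 : lam 0 0 = 0.
  by apply: (addrI (lam 0 0)); rewrite -(quad_biadd lam_mu).1 !addr0.
apply: (mulgI (mu 0)); rewrite mulg1.
by rewrite -[RHS](congr1 mu (addr0 0)) (quad_muD lam_mu) lam00 qg_p0 mulg1.
Qed.

(** In a possibly non-commutative [M_e], [mu] is multiplicative up to the cocycle
    [- lam], the one that twists the group law of [twprod]. *)
Lemma quad_muM a b : (mu a * mu b = qg_p (- lam a b) * mu (a + b))%g.
Proof.
rewrite (quad_muD lam_mu) qg_p_central -mulgA -qg_pD subrr.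
by rewrite qg_p0 mulg1.
Qed.

End QuadForm.

(** * The free quadratic form on a hermitian form *)

Definition tw_obj (X : hf_obj) : qf_obj :=
  qf_of_refinement (tw_refinement (hf_form X)).

(** The unit of the adjunction is the identity on [A] and on [M]; its content
    is that [h_lambda p_lambda - id] is the given involution. *)
Definition tw_unit (X : hf_obj) : hf_hom X (forget_obj (tw_obj X)).
Proof.
refine (@HFHom X (forget_obj (tw_obj X))
  (idfun : {additive hf_A X -> hf_A X}) (idfun : {additive hf_M X -> hf_M X})
  _ _) => //.
exact: (tw_refines (hf_form X)).
Defined.

Lemma tw_decomp (A : zmodType) (M : invZmodType) (lam : hermitian A M)
    (x : twprod lam) :
  x = (tw_p lam x.1 * tw_mu lam x.2)%g.
Proof.
by case: x => m a; rewrite tw_mulE /tw_add /= herm0l subr0 addr0 add0r.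
Qed.

Section Restriction.
Variables (X : hf_obj) (Y : qf_obj).

Definition tw_restrict (g : qf_hom (tw_obj X) Y) : hf_hom X (forget_obj Y) :=
  hf_comp (forget_hom g) (tw_unit X).

Lemma tw_beta_eE (g : qf_hom (tw_obj X) Y) (x : twprod (hf_form X)) :
  beta_e (qf_beta g) x =
    (qg_p (beta_ee (qf_beta g) x.1) * qf_mu (qf_alpha g x.2))%g.
Proof. by rewrite {1}[x]tw_decomp gmulfM beta_p qf_muE. Qed.

(** Unlike [qf_hom_ext], equality of the [beta_e] components comes for free when
    the source is [tw_obj X], since [M] and [A] generate its [M_e]. *)
Lemma tw_hom_ext (g k : qf_hom (tw_obj X) Y) :
  qf_alpha g =1 qf_alpha k ->
  beta_ee (qf_beta g) =1 beta_ee (qf_beta k) -> g = k.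
Proof.
move=> eq_alpha eq_beta; apply: qf_hom_ext => // x.
by rewrite !tw_beta_eE eq_alpha eq_beta.
Qed.

End Restriction.

Section Lift.
Variables (X : hf_obj) (Y : qf_obj) (f : hf_hom X (forget_obj Y)).

Definition tw_lift_e (x : twprod (hf_form X)) : qf_Q Y :=
  (qg_p (hf_beta f x.1) * qf_mu (hf_alpha f x.2))%g.

Lemma tw_lift_eM : {morph tw_lift_e : x y / (x * y)%g}.
Proof.
move=> [m a] [m' a']; rewrite tw_mulE /tw_lift_e /tw_add /=.
rewrite !raddfD raddfN /= !qg_pD -(hf_formE f).
rewrite -!mulgA -(quad_muM (qf_form Y)); congr (_ * _)%g.
by rewrite !mulgA qg_p_central.
Qed.

HB.instance Definition _ :=
  isMultiplicative.Build (twprod (hf_form X)) (qf_Q Y) tw_lift_e tw_lift_eM.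

(** The summand [star x.1] of [tw_h] is matched by [h p - id] in [Y]: this is
    where [hf_beta f] has to respect the involutions. *)
Lemma tw_lift_h x : qg_h (tw_lift_e x) = hf_beta f (tw_h x).
Proof.
rewrite /tw_lift_e /tw_h qg_hM (quad_hmu (qf_form Y)) !raddfD /=.
rewrite -(hf_formE f) (hf_beta_star f) /= /qg_star.
by rewrite [hf_beta f _ + _]addrC subrK.
Qed.

Lemma tw_lift_p m : qg_p (hf_beta f m) = tw_lift_e (tw_p (hf_form X) m).
Proof. by rewrite /tw_lift_e /= raddf0 (quad_mu0 (qf_form Y)) mulg1. Qed.

Lemma tw_lift_mu a :
  qf_mu (hf_alpha f a) = tw_lift_e (tw_mu (hf_form X) a).
Proof. by rewrite /tw_lift_e /= raddf0 qg_p0 mul1g. Qed.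

Definition tw_lift_qg : quadGroup_hom (twQuadGroup (hf_form X)) (qf_Q Y) :=
  @QuadGroupHom _ _ (twQuadGroup (hf_form X)) (qf_Q Y)
    tw_lift_e (hf_beta f) tw_lift_h tw_lift_p.

Definition tw_lift : qf_hom (tw_obj X) Y :=
  @QFHom (tw_obj X) Y (hf_alpha f) tw_lift_qg (hf_formE f) tw_lift_mu.

End Lift.

(** * The adjunction *)

Definition tw_functor : functor HF QF.
Proof.
exists tw_obj (fun X Y f => tw_lift (hf_comp (tw_unit Y) f)).
- by move=> X; apply: tw_hom_ext.
- by move=> X Y Z f g; apply: tw_hom_ext.
Defined.

(** Restricting and lifting leave [alpha] and [beta_ee] unchanged, and these
    two components determine a morphism on both sides; bijectivity and
    naturality therefore hold by computation. *)
Lemma tw_adjoint : left_adjoint tw_functor forget.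
Proof.
exists tw_restrict; split.
- move=> X Y; exists (@tw_lift X Y) => [g|f]; first exact: tw_hom_ext.
  exact: hf_hom_ext.
- by move=> X X' Y f g; apply: hf_hom_ext.
- by move=> X Y Y' k g; apply: hf_hom_ext.
Qed.

(** * Initiality among the refinements *)

Section Initial.
Variables (A : zmodType) (M : invZmodType) (lam : hermitian A M).

(** The involution of [R Y] is [h p - id] and not [star] itself, so the
    identity of [lam] is a morphism only because [Y] refines [M]. *)
Definition refinement_hf (Y : refinement lam) :
  hf_hom (HFObj lam) (forget_obj Y).
Proof.
refine (@HFHom (HFObj lam) (forget_obj Y)
  (idfun : {additive A -> A}) (idfun : {additive M -> M}) _ _) => //.
exact: (ref_refines Y).
Defined.

Lemma tw_initial : initial (Refinements lam) (tw_refinement lam).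
Proof.
move=> Y.
have lift_alpha a : qf_alpha (tw_lift (refinement_hf Y)) a = a by [].
have lift_beta m : beta_ee (qf_beta (tw_lift (refinement_hf Y))) m = m by [].
exists (@RefinementHom A M lam (tw_refinement lam) Y _ lift_alpha lift_beta).
move=> g; apply: refinement_hom_ext => x.
rewrite (@tw_beta_eE (HFObj lam) Y (ref_hom g)).
by rewrite (ref_alpha_id g) (ref_beta_ee_id g).
Qed.

End Initial.

Theorem theorem19 :
  (forall (A : zmodType) (M : invZmodType) (lam : hermitian A M),
     initial (Refinements lam) (tw_refinement lam)) /\
  (exists L : functor HF QF,
     (forall (A : zmodType) (M : invZmodType) (lam : hermitian A M),
        L (HFObj lam) = qf_of_refinement (tw_refinement lam)) /\
     left_adjoint L forget).
Proof.
split; first exact: tw_initial.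
by exists tw_functor; split; last exact: tw_adjoint.
Qed.
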